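(* Let $X=(a_1,a_2,a_3)$ be a smooth vector field on $\mathbb{R}^3$. Let $P=\mathbb{R}^3\times S^1$ be the trivial $S^1$-principal bundle over $\mathbb{R}^3$, endowed with the connection $1$-form $\omega=d\theta+\sum_{i=1}^3 a_i\,dx_i$. For any smooth closed curve $c:[0,L]\to\mathbb{R}^3$ parametrized by arc length, the complex torus $c^*P$ is biholomorphic to $\mathbb{C}/\Lambda$, where the lattice is $$\Lambda=2\pi\mathbb{Z}+\left(\oint_c X\cdot ds+iL\right)\mathbb{Z}.$$
   Context: $\mathbb{R}^3$ carries the Euclidean metric. Coordinates on $P=\mathbb{R}^3\times S^1$ are $(x_1,x_2,x_3,\theta)\mapsto(x_1,x_2,x_3,e^{i\theta})$, the right action of $S^1$ is multiplication on the second factor, and $\partial_\theta$ is the corresponding vertical vector field. Also $\oint_c X\cdot ds=\int_0^L\sum_i a_i(c(t))c_i'(t)\,dt$. A smooth closed curve $c:[0,L]\to\mathbb{R}^3$ is one whose $L$-periodic extension to $\mathbb{R}$ is smooth, and $c^*P$ denotes the total space of the pullback bundle over the circle $\mathbb{R}/L\mathbb{Z}$. The complex torus $c^*P$ is this total space (a manifold diffeomorphic to $S^1\times S^1$) with the complex structure $J$ induced by the connection and the metric, namely $J\partial_\theta=\widetilde{c'}$, $J\widetilde{c'}=-\partial_\theta$, where $\widetilde{c'}$ is the horizontal lift (i.e. the lift in the kernel of the connection form) of the unit tangent field $c'$. Equivalently, if $\eta$ is a horizontal lift (a lift with $\omega(\eta')=0$) of the $L$-periodic extension of $c$ to $\mathbb{R}$,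 it is the complex structure for which $s_1+is_2\mapsto\eta(s_2)\cdot e^{is_1}$ is locally biholomorphic. *)

(* Defs.v *)
From HB Require Import structures.
(* MathComp-Analysis, over an arbitrary [R : realType] *)
From mathcomp Require Import all_boot all_order all_algebra.
From mathcomp Require Import generic_quotient complex.
From mathcomp Require Import all_classical all_reals all_analysis.
From mathcomp Require Import ring lra.
Set Implicit Arguments.
Unset Strict Implicit.
Unset Printing Implicit Defensive.
Import Order.TTheory GRing.Theory Num.Theory numFieldNormedType.Exports.
Local Open Scope classical_set_scope.
Local Open Scope ring_scope.
Local Open Scope complex_scope.

Section Smooth.
Context {R : realType}.
Implicit Types V W Z : normedModType R.

(* C^k regularity; only meaningful when the set [U] is open. *)
Fixpoint Ck_on V W (k : nat) (U : set V) (f : V -> W) : Prop :=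
  match k with
  | 0%N => forall x, U x -> {for x, continuous f}
  | k'.+1 => (forall x, U x -> differentiable f x) /\
             forall v, Ck_on k' U ('D_v f)
  end.

Definition smooth_on V W (U : set V) (f : V -> W) := forall k, Ck_on k U f.

Definition smooth V W (f : V -> W) := smooth_on setT f.

Lemma near_eq_diff V W (f g : V -> W) x :
    (\forall y \near x, f y = g y) -> differentiable f x ->
  differentiable g x /\ 'd g x = 'd f x :> (V -> W).
Proof.
move=> fg /diff_locallyP[dfc dfx].
have gE : g \o shift x = cst (g x) + 'd f x +o_ 0 id.
  apply/eqaddoP => e e0.
  have /eqaddoP/(_ e e0) {}dfx := dfx.
  have fg0 : \forall h \near (0 : V), f (h + x) = g (h + x).
    by have := fg; rewrite (near_shift 0) subr0.
  have <- : f x = g x by exact: nbhs_singleton fg.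
  near=> h; rewrite !fctE/=.
  have <- : f (h + x) = g (h + x) by near: h.
  by near: h.
have E := diff_unique dfc gE.
by split=> //; apply/diff_locallyP; rewrite E.
Unshelve. all: by end_near. Qed.

Lemma Ck_on_cts V W k (U : set V) (f : V -> W) x :
  Ck_on k U f -> U x -> {for x, continuous f}.
Proof.
case: k => [|k] /= => [fc|[df _]] Ux; first exact: fc.
exact/differentiable_continuous/df.
Qed.

Lemma Ck_on_local V W k (U : set V) (f : V -> W) :
  (forall x, U x -> exists2 U', U' x & Ck_on k U' f) -> Ck_on k U f.
Proof.
elim: k f => [|k IH] f H /=; first by move=> x /H[U' U'x fU]; exact: fU.
split=> [x /H[U' U'x [df _]]|v]; first exact: df.
by apply: IH => x /H[U' U'x [_ D]]; exists U' => //; exact: D.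
Qed.

Lemma Ck_onS V W k (U U' : set V) (f : V -> W) :
  U `<=` U' -> Ck_on k U' f -> Ck_on k U f.
Proof. by move=> UU' fU; apply: Ck_on_local => x /UU'; exists U'. Qed.

Lemma eq_Ck_on V W k (U : set V) (f g : V -> W) : open U ->
  (forall x, U x -> f x = g x) -> Ck_on k U f -> Ck_on k U g.
Proof.
move=> Uo; elim: k f g => [|k IH] f g fg /=.
  move=> fc x Ux; have /fc := Ux; rewrite /prop_for /continuous_at -fg// => ff.
  apply: cvg_trans ff; apply: near_eq_cvg.
  by apply: filterS (open_nbhs_nbhs (conj Uo Ux)) => y /fg.
have E x : U x -> \forall y \near x, f y = g y.
  by move=> Ux; apply: filterS (open_nbhs_nbhs (conj Uo Ux)) => y /fg.
move=> [df Df]; split=> [x Ux|v]; last first.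
  by apply: IH (Df v) => x /E; exact: near_eq_derive.
exact: (near_eq_diff (E _ Ux) (df _ Ux)).1.
Qed.

Lemma Ck_on_cst V W k (U : set V) (w : W) : Ck_on k U (cst w).
Proof.
elim: k w => [|k IH] w /=; first by move=> x _; exact: cst_continuous.
split=> [x _|v]; first exact: differentiable_cst.
rewrite (_ : 'D_v _ = cst 0) //; apply/funext => x; exact: derive_cst.
Qed.

Lemma Ck_onW V W k (U : set V) (f : V -> W) : open U ->
  Ck_on k.+1 U f -> Ck_on k U f.
Proof.
move=> Uo; elim: k f => [|k IH] f.
  by move=> [df _] x Ux; exact/differentiable_continuous/df.
by move=> [df Df]; split=> // v; apply/IH/Df.
Qed.

Lemma Ck_onD V W k (U : set V) (f g : V -> W) : open U ->
  Ck_on k U f -> Ck_on k U g -> Ck_on k U (f \+ g).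
Proof.
move=> Uo; elim: k f g => [|k IH] f g.
  by move=> fc gc x Ux; apply: (@continuousD _ _ _ f g); [exact: fc|exact: gc].
move=> [df Df] [dg Dg]; split=> [x Ux|v].
  by apply: (@differentiableD _ _ _ f g); [exact: df|exact: dg].
apply: eq_Ck_on (IH _ _ (Df v) (Dg v)) => // x Ux /=.
by rewrite -deriveD//; [exact/diff_derivable/df|exact/diff_derivable/dg].
Qed.

Lemma Ck_on_sum V W k (U : set V) n (f : 'I_n -> V -> W) : open U ->
  (forall i, Ck_on k U (f i)) -> Ck_on k U (fun x => \sum_i f i x).
Proof.
move=> Uo; elim: n f => [|n IH] f fC.
  by apply: eq_Ck_on (Ck_on_cst k U 0) => // x _; rewrite big_ord0.
apply: eq_Ck_on (Ck_onD Uo (IH _ (fun i => fC (widen_ord (leqnSn n) i))) (fC ord_max)) => // x _.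
by rewrite big_ord_recr.
Qed.

Lemma Ck_onM V k (U : set V) (f g : V -> R) : open U ->
  Ck_on k U f -> Ck_on k U g -> Ck_on k U (f \* g).
Proof.
move=> Uo; elim: k f g => [|k IH] f g.
  by move=> fc gc x Ux; apply: (@continuousM _ _ f g); [exact: fc|exact: gc].
move=> fC gC; have [df Df] := fC; have [dg Dg] := gC; split=> [x Ux|v].
  by apply: (@differentiableM _ _ f g); [exact: df|exact: dg].
apply: eq_Ck_on (Ck_onD Uo (IH _ _ (Ck_onW Uo fC) (Dg v))
  (IH _ _ (Ck_onW Uo gC) (Df v))) => // x Ux /=.
by rewrite deriveM//; [exact/diff_derivable/df|exact/diff_derivable/dg].
Qed.

Lemma Ck_on_lin V W Z k (U : set V) (f : V -> W) (l : {linear W -> Z}) :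
  open U -> continuous l -> Ck_on k U f -> Ck_on k U (l \o f).
Proof.
move=> Uo lc; elim: k f => [|k IH] f.
  by move=> fc x Ux; apply: continuous_comp; [exact: fc|exact: lc].
move=> [df Df]; split=> [x Ux|v].
  apply: differentiable_comp; [exact: df|exact: linear_differentiable].
apply: eq_Ck_on (IH _ (Df v)) => // x Ux /=.
have dl : differentiable l (f x) by exact: linear_differentiable.
rewrite [RHS]deriveE; last by apply: differentiable_comp; [exact: df|].
rewrite diff_comp//; last exact: df.
by rewrite /= diff_lin// deriveE//; exact: df.
Qed.

Lemma Ck_on_coord V k m n (U : set V) (f : V -> 'M[R]_(m, n)) i j : open U ->
  Ck_on k U f -> Ck_on k U (fun x => f x i j).
Proof.
move=> Uo.
have @l : {linear 'M[R]_(m, n) -> R}.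
  by exists (fun N : 'M[R]_(_, _) => N i j); do 2![eexists]; do ?[constructor];
     rewrite ?mxE// => ? *; rewrite ?mxE//; move=> ?; rewrite !mxE.
exact: (Ck_on_lin (l := l) Uo (@coord_continuous _ _ _ _ _)).
Qed.

Lemma Ck_on_pair V W Z k (U : set V) (f : V -> W) (g : V -> Z) : open U ->
  Ck_on k U f -> Ck_on k U g -> Ck_on k U (fun x => (f x, g x)).
Proof.
move=> Uo; elim: k f g => [|k IH] f g.
  by move=> fc gc x Ux; apply: cvg_pair; [exact: fc|exact: gc].
move=> [df Df] [dg Dg]; split=> [x Ux|v].
  by apply: differentiable_pair; [exact: df|exact: dg].
apply: eq_Ck_on (IH _ _ (Df v) (Dg v)) => // x Ux /=.
have dfx := df _ Ux; have dgx := dg _ Ux.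
rewrite [RHS]deriveE; last exact: differentiable_pair.
by rewrite diff_pair// !deriveE.
Qed.

Lemma diff_sum_coord n (Z : normedModType R) (g : 'rV[R]_n -> Z) y (v : 'rV[R]_n) :
  differentiable g y ->
  'd g y v = \sum_i (v 0 i *: 'D_(delta_mx 0 i) g y).
Proof.
move=> dg; rewrite {1}(row_sum_delta v) linear_sum; apply: eq_bigr => i _.
by rewrite linearZ/= deriveE.
Qed.

Lemma Ck_on_comp_row V n k (U : set V) (f : V -> 'rV[R]_n) (g : 'rV[R]_n -> R) :
  open U -> Ck_on k U f -> Ck_on k setT g -> Ck_on k U (g \o f).
Proof.
move=> Uo; elim: k f g => [|k IH] f g.
  by move=> fc gc x Ux; apply: continuous_comp; [exact: fc|exact: gc].
move=> fC gC; have [df Df] := fC; have [dg Dg] := gC.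
split=> [x Ux|v].
  by apply: differentiable_comp; [exact: df|exact: dg].
apply: (@eq_Ck_on _ _ _ _
  (fun x => \sum_i ('D_v f x 0 i * ('D_(delta_mx 0 i) g \o f) x))) => //.
  move=> x Ux; have dfx := df _ Ux; have dgx := dg _ I.
  rewrite [RHS]deriveE; last exact: differentiable_comp.
  by rewrite (@diff_comp _ _ _ _ f g)//= diff_sum_coord// deriveE.
apply: Ck_on_sum => // i; apply: (@Ck_onM _ _ _ (fun x => 'D_v f x 0 i)) => //.
  exact: (Ck_on_coord 0 i Uo (Df v)).
by apply: IH; [exact: Ck_onW fC|exact: Dg].
Qed.

Lemma Ck_on_prelin V W Z k (f : W -> Z) (l : {linear V -> W}) :
  continuous l -> Ck_on k setT f -> Ck_on k setT (f \o l).
Proof.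
move=> lc; elim: k f => [|k IH] f.
  by move=> fc x _; apply: continuous_comp; [exact: lc|exact: fc].
move=> [df Df]; split=> [x _|v].
  apply: differentiable_comp; [exact: linear_differentiable|exact: df].
rewrite (_ : 'D_v _ = 'D_(l v) f \o l); first exact: (IH _ (Df _)).
apply/funext => x /=.
have dl : differentiable l x by exact: linear_differentiable.
rewrite deriveE; last by apply: differentiable_comp => //; exact: df.
rewrite diff_comp//=; last exact: df.
by rewrite diff_lin// deriveE//; exact: df.
Qed.

Lemma smooth_shift V (U : set V) (w : V) : smooth_on U (fun x => x + w).
Proof.
case=> [|k] /=.
  by move=> x _; apply: continuousD => //; exact: cst_continuous.
split=> [x _|v].
  by apply: (@differentiableD _ _ _ id (cst w)) => //; exact: differentiable_cst.
rewrite (_ : 'D_v _ = cst v); first exact: Ck_on_cst.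
apply/funext => x; rewrite (@deriveD _ _ _ id (cst w)) ?derive_id ?derive_cst ?addr0//.
Qed.

Lemma diff_shift V (x w : V) : 'd (fun x => x + w) x = id :> (V -> V).
Proof.
have dw : differentiable (cst w : V -> V) x by exact: differentiable_cst.
rewrite (@diffD _ _ _ id (cst w)) ?diff_cst//.
by apply/funext => v /=; rewrite addr0 diff_val.
Qed.
End Smooth.

Lemma inIntSpan0 (V : zmodType) m (s : m.-tuple V) : inIntSpan s 0.
Proof.
by exists [ffun=> 0]; rewrite big1// => i _; rewrite ffunE mulr0z.
Qed.

Lemma inIntSpanB (V : zmodType) m (s : m.-tuple V) x y :
  inIntSpan s x -> inIntSpan s y -> inIntSpan s (x - y).
Proof.
move=> [a ->] [b ->]; exists [ffun i => a i - b i].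
by rewrite -sumrB; apply: eq_bigr => i _; rewrite ffunE mulrzBr.
Qed.

Lemma inIntSpanN (V : zmodType) m (s : m.-tuple V) x :
  inIntSpan s x -> inIntSpan s (- x).
Proof. by rewrite -sub0r; apply: inIntSpanB; exact: inIntSpan0. Qed.

Lemma inIntSpanD (V : zmodType) m (s : m.-tuple V) x y :
  inIntSpan s x -> inIntSpan s y -> inIntSpan s (x + y).
Proof. by move=> sx sy; rewrite -(opprK y); apply/inIntSpanB/inIntSpanN. Qed.

Lemma inIntSpan2 (V : zmodType) (g h x : V) :
  inIntSpan [tuple g; h] x <-> exists m n : int, x = g *~ m + h *~ n.
Proof.
split=> [[a ->]|[m [n ->]]].
  by exists (a ord0), (a (lift ord0 ord0)); rewrite !big_ord_recl big_ord0 addr0.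
exists [ffun i => if i == ord0 then m else n].
by rewrite !big_ord_recl big_ord0 addr0/= !ffunE.
Qed.

Lemma inIntSpan1 (V : zmodType) (g x : V) :
  inIntSpan [tuple g] x <-> exists m : int, x = g *~ m.
Proof.
split=> [[a ->]|[m ->]]; first by exists (a ord0); rewrite big_ord1.
by exists [ffun=> m]; rewrite big_ord1 ffunE.
Qed.

Section Quotient.
Variables (V : zmodType) (m : nat) (s : m.-tuple V).

Definition span_rel : rel V := fun x y => `[< inIntSpan s (x - y) >].

Fact span_rel_refl : reflexive span_rel.
Proof. by move=> x; apply/asboolP; rewrite subrr; exact: inIntSpan0. Qed.

Fact span_rel_sym : symmetric span_rel.
Proof.
by move=> x y; apply/asboolP/asboolP => /inIntSpanN; rewrite opprB.
Qed.

Fact span_rel_trans : transitive span_rel.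
Proof.
move=> y x z /asboolP xy /asboolP yz; apply/asboolP.
by rewrite -(subrKA y); exact: inIntSpanD.
Qed.

Canonical span_equiv :=
  EquivRel span_rel span_rel_refl span_rel_sym span_rel_trans.

(* The quotient group of [V] by the subgroup of the integral combinations of
   [s]: R/LZ is [zquot [tuple L]] and C/(Z w1 + Z w2) is
   [zquot [tuple w1; w2]]. *)
Definition zquot := {eq_quot span_equiv}%qT.

Definition zclass (x : V) : zquot := (\pi x)%qT.

Lemma zclassP x y : zclass x = zclass y <-> inIntSpan s (x - y).
Proof. by split=> [/eqmodP/asboolP|?]//; apply/eqmodP/asboolP. Qed.

Lemma zclassK (q : zquot) : zclass (repr q) = q.
Proof. exact: reprK. Qed.

End Quotient.

(* [g] is a smooth map on [U] whose differential intertwines the almost complex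
   structures [J] (at the source) and [J'] (at the target). *)
Definition pseudo_holo (R : realType) (J J' : R * R -> R * R -> R * R)
    (U : set (R * R)) (g : R * R -> R * R) :=
  smooth_on U g /\
  forall x v, U x -> 'd g x (J x v) = J' (g x) ('d g x v).

(* A smooth real surface with an almost complex structure. Charts are given by
   their inverses: [par i] maps the open set [dom i] of R^2 injectively into the
   surface, and [acs i x] is the endomorphism J of the tangent space at
   [par i x], read in the coordinates of the chart [i]. The topology is the one
   making every [par i : dom i -> _] an open embedding; [par_cover] says that
   countably many charts suffice to cover. *)
Record almost_complex_surface (R : realType) := AlmostComplexSurface {
  surface_pt :> Type;
  chart : Type;
  dom : chart -> set (R * R);
  par : chart -> R * R -> surface_pt;
  acs : chart -> R * R -> {linear (R * R)%type -> (R * R)%type};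
  dom_open : forall i, open (dom i);
  par_inj : forall i, {in dom i &, injective (par i)};
  par_cover : exists a : nat -> chart,
    forall p, exists n x, dom (a n) x /\ par (a n) x = p;
  par_hausdorff : forall p q, p <> q -> exists i j U V,
    [/\ open U /\ open V, U `<=` dom i /\ V `<=` dom j,
        (par i @` U) p, (par j @` V) q & par i @` U `&` par j @` V = set0];
  par_trans : forall i j,
    let W := dom i `&` par i @^-1` (par j @` dom j) in
    open W /\ exists g, [/\ forall x, W x -> dom j (g x),
        forall x, W x -> par j (g x) = par i x &
        pseudo_holo (acs i) (acs j) W g];
  acs_smooth : forall i v, smooth_on (dom i) (fun x => acs i x v);
  acs_sq : forall i x v, dom i x -> acs i x (acs i x v) = - v }.

Definition holomorphic (R : realType) (M N : almost_complex_surface R) (F : M -> N) :=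
  forall (i : chart M) x, dom i x ->
  exists (j : chart N) (U : set (R * R)) (g : R * R -> R * R),
    [/\ open U, U x, U `<=` dom i,
        forall y, U y -> dom j (g y) /\ par j (g y) = F (par i y) &
        pseudo_holo (acs i) (acs j) U g].

(* For surfaces, almost complex structures are integrable, so that a
   diffeomorphism intertwining them is a biholomorphism. *)
Definition biholomorphic (R : realType) (M N : almost_complex_surface R) :=
  exists (F : M -> N) (G : N -> M),
    [/\ cancel F G, cancel G F, holomorphic F & holomorphic G].

(* Common construction of the two surfaces below: if the fibres of a surjection
   [Phi] from R^2 are the cosets of the lattice Z g1 + Z g2, its restrictions to
   the open sets on which it is injective are the (inverses of) charts of a
   surface, and a lattice-invariant almost complex structure on R^2 descends to
   that surface. *)
Section LatticeSurface.
Context {R : realType}.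
Variables (T : Type) (Phi : R * R -> T) (g1 g2 : R * R).
Variable (J : R * R -> {linear (R * R)%type -> (R * R)%type}).
Hypothesis g_indep : g1.1 * g2.2 - g1.2 * g2.1 != 0.
Hypothesis Phi_surj : forall p, exists x, Phi x = p.
Local Notation Gam := (inIntSpan [tuple g1; g2]).
Hypothesis PhiP : forall x y, Phi x = Phi y <-> Gam (x - y).
Hypothesis J_per : forall x g v, Gam g -> J (x + g) v = J x v.
Hypothesis J_smooth : forall v, smooth (fun x => J x v).
Hypothesis J_sq : forall x v, J x (J x v) = - v.

Lemma mulrz_pair (g : R * R) (m : int) : (g *~ m) = (g.1 *~ m, g.2 *~ m).
Proof.
by rewrite [LHS]surjective_pairing (raddfMz (fst : {additive (R*R)%type -> R}))
  (raddfMz (snd : {additive (R*R)%type -> R})).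
Qed.

Fact small_int (m : int) (a b : R) : b != 0 -> m%:~R * b = a -> `|a| < `|b| ->
  m = 0.
Proof.
move=> b0 <-; rewrite normrM; apply: contraTeq => m0.
by rewrite -leNgt ler_peMl// -intr_norm ler1z -gtz0_ge1 normr_gt0.
Qed.

Lemma lattice_gap : exists2 e : R, 0 < e &
  forall g, Gam g -> `|g| < e -> g = 0.
Proof.
pose D := g1.1 * g2.2 - g1.2 * g2.1.
have D0 : D != 0 by exact: g_indep.
pose N := 1 + `|g1.1| + `|g1.2| + `|g2.1| + `|g2.2|.
have N0 : 0 < N by rewrite /N -!addrA ltr_pwDl// !addr_ge0.
have cross (u1 u2 h1 h2 : R) : `|u1| < `|D| / N -> `|u2| < `|D| / N ->
    1 + `|h1| + `|h2| <= N -> `|u1 * h2 - u2 * h1| < `|D|.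
  move=> l1 l2 hN.
  apply: (@lt_le_trans _ _ (`|D| / N * (1 + `|h1| + `|h2|))); last first.
    by rewrite mulrAC ler_pdivrMr// ler_wpM2l.
  rewrite (le_lt_trans (ler_normB _ _))// !normrM.
  have DN : 0 < `|D| / N by rewrite divr_gt0 ?normr_gt0.
  rewrite !mulrDr mulr1 -addrA ltr_pwDl// addrC lerD//.
    by rewrite ler_wpM2r// ltW.
  by rewrite ler_wpM2r// ltW.
exists (`|D| / N); first by rewrite divr_gt0 ?normr_gt0.
move=> g /inIntSpan2[m [n gE]].
have [g1E g2E] : g.1 = g1.1 * m%:~R + g2.1 * n%:~R /\
    g.2 = g1.2 * m%:~R + g2.2 * n%:~R.
  by rewrite gE !mulrz_pair/= !mulrzr.
rewrite prod_normE gt_max => /andP[/= l1 l2].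
have m0 : m = 0.
  apply: (small_int (a := g.1 * g2.2 - g.2 * g2.1) D0).
    rewrite g1E g2E /D; ring.
  apply: cross => //; rewrite /N.
  have := normr_ge0 g1.1; have := normr_ge0 g1.2; lra.
have n0 : n = 0.
  apply: (small_int (a := - (g.1 * g1.2 - g.2 * g1.1)) D0).
    rewrite g1E g2E /D; ring.
  rewrite normrN; apply: cross => //; rewrite /N.
  have := normr_ge0 g2.1; have := normr_ge0 g2.2; lra.
by rewrite gE m0 n0 !mulr0z addr0.
Qed.

Definition latt_chart :=
  {W : set (R * R) | open W /\ {in W &, injective Phi}}.

Let dm (i : latt_chart) := sval i.
Let pr (i : latt_chart) := Phi.
Let J' (i : latt_chart) := J.

Lemma latt_ball e : (forall g, Gam g -> `|g| < e -> g = 0) ->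
  forall (x : R * R) r, 0 < r -> r <= e / 2 ->
  open (ball x r) /\ {in (ball x r : set (R * R)) &, injective Phi}.
Proof.
move=> H x r r0 re; split; first exact: ball_open.
move=> y z; rewrite !inE -ball_normE/= => xy xz /PhiP/H yz.
apply/eqP; rewrite -subr_eq0; apply/eqP/yz.
rewrite -(subrKA x) (le_lt_trans (ler_normD _ _))// (splitr e).
by rewrite ltrD// ?[`|y - x|]distrC (lt_le_trans _ re).
Qed.

Fact latt_open i : open (dm i). Proof. by case: i => W []. Qed.

Fact latt_inj i : {in dm i &, injective (pr i)}.
Proof. by case: i => W []. Qed.

Fact latt_cover : exists a : nat -> latt_chart,
  forall p, exists n x, dm (a n) x /\ pr (a n) x = p.
Proof.
have [e e0 H] := lattice_gap.
have e20 : 0 < e / 2 by rewrite divr_gt0.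
pose b (q : rat * rat) : latt_chart :=
  exist _ (ball (ratr q.1 : R, ratr q.2 : R) (e / 2)) (latt_ball H _ e20 (lexx _)).
exists (fun n => b (odflt (0, 0) (unpickle n))) => p.
have [x <-] := Phi_surj p.
have dense (y : R) : exists q : rat, `|ratr q - y| < e / 2.
  have [|q] := @rat_in_itvoo R (y - e / 2) (y + e / 2).
    by rewrite ltrBlDr -addrA ltrDl addr_gt0.
  by rewrite in_itv/= => qy; exists q; rewrite ltr_distl.
have [q1 H1] := dense x.1; have [q2 H2] := dense x.2.
exists (pickle (q1, q2)), x; rewrite pickleK; split; last by [].
by split; rewrite -ball_normE.
Qed.

Fact latt_hausdorff p q : p <> q -> exists i j U V,
    [/\ open U /\ open V, U `<=` dm i /\ V `<=` dm j,
        (pr i @` U) p, (pr j @` V) q & pr i @` U `&` pr j @` V = set0].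
Proof.
have [e e0 H] := lattice_gap.
have [x <-] := Phi_surj p; have [y <-] := Phi_surj q => xy.
have [d d0 dH] : exists2 d, 0 < d & forall g, Gam g -> d <= `|x - y - g|.
  have [[g0 [G0 l0]]|nex] :=
      pselect (exists g0, Gam g0 /\ `|x - y - g0| < e / 2); last first.
    exists (e / 2); first by rewrite divr_gt0.
    by move=> g Gg; rewrite leNgt; apply/negP => l; apply: nex; exists g.
  exists `|x - y - g0|.
    rewrite normr_gt0 subr_eq0; apply/eqP => E.
    by apply: xy; apply/PhiP; rewrite E.
  move=> g Gg; have [->//|gg0] := eqVneq g g0.
  rewrite (le_trans (ltW l0))// leNgt; apply/negP => l.
  move/eqP: gg0; apply; apply/eqP; rewrite -subr_eq0; apply/eqP/H.
    exact: inIntSpanB.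
  rewrite (_ : g - g0 = (x - y - g0) - (x - y - g)); last first.
    by rewrite opprB [RHS]addrC subrKA.
  by rewrite (le_lt_trans (ler_normB _ _))// (splitr e) ltrD.
pose r := Num.min d e / 2.
have r0 : 0 < r by rewrite divr_gt0// lt_min d0.
have re : r <= e / 2 by rewrite ler_pM2r// ge_min lexx orbT.
pose b z : latt_chart := exist _ (ball z r) (latt_ball H z r0 re).
exists (b x), (b y), (ball x r), (ball y r); split=> //.
- by split; exact: ball_open.
- by split.
- by exists x => //; exact: ballxx.
- by exists y => //; exact: ballxx.
apply/seteqP; split=> // z /= [[a xa <-] [c yc]] /esym/PhiP /dH.
rewrite leNgt => /negP; apply.
have -> : x - y - (a - c) = (x - a) - (y - c).
  by rewrite !opprB !addrA; rewrite -!addrA; congr (_ + _); rewrite addrCA [RHS]addrCA; congr (_ + _); rewrite addrC.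
move: xa yc; rewrite -ball_normE/= => xa yc.
rewrite (le_lt_trans (ler_normB _ _))//.
have : r + r <= d by rewrite -splitr ge_min lexx.
by apply: lt_le_trans; rewrite ltrD.
Qed.

Lemma Phi_shift x g : Gam g -> Phi (x + g) = Phi x.
Proof. by move=> Gg; apply/PhiP; rewrite addrC addKr. Qed.

Fact latt_trans i j :
  let W := dm i `&` pr i @^-1` (pr j @` dm j) in
  open W /\ exists g, [/\ forall x, W x -> dm j (g x),
      forall x, W x -> pr j (g x) = pr i x &
      pseudo_holo (J' i) (J' j) W g].
Proof.
move=> W.
pose g x := get [set y | dm j y /\ Phi y = Phi x].
have gP x : W x -> dm j (g x) /\ Phi (g x) = Phi x.
  by move=> [_ [y jy yx]]; apply: (@getPex _ [set y | dm j y /\ Phi y = Phi x]); exists y.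
pose U x := dm i `&` (fun z => z + (g x - x)) @^-1` dm j.
have UG x : W x -> Gam (g x - x) by move=> /gP[_ /PhiP].
have Uo x : open (U x).
  apply: openI; first exact: latt_open.
  apply: open_comp; last exact: latt_open.
  by move=> z _; exact: (@smooth_shift R _ setT (g x - x) 0%N z I).
have Ux x : W x -> U x x.
  by move=> Wx; split; [case: Wx|rewrite /= addrC subrK; exact: (gP _ Wx).1].
have UW x : W x -> U x `<=` W.
  move=> /UG Gx z [iz jz]; split=> //; exists (z + (g x - x)) => //.
  exact: Phi_shift.
have gE x z : W x -> U x z -> g z = z + (g x - x).
  move=> Wx Uz; have [j1 E] := gP _ (UW _ Wx _ Uz).
  apply: (@latt_inj j); rewrite ?inE//; first exact: Uz.2.
  by rewrite /pr E Phi_shift//; exact: UG.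
split.
  rewrite openE => x Wx; apply: filterS (UW _ Wx) _.
  by apply: open_nbhs_nbhs; split; [exact: Uo|exact: Ux].
exists g; split; [by move=> x /gP[]|by move=> x /gP[]|split].
  move=> k; apply: Ck_on_local => x Wx; exists (U x); first exact: Ux.
  apply: eq_Ck_on (smooth_shift (U x) (g x - x) k); first exact: Uo.
  by move=> z /(gE _ _ Wx).
move=> x v Wx.
have dg : 'd g x = id :> (R * R -> R * R).
  rewrite -(diff_shift x (g x - x)).
  have E : \forall y \near x, y + (g x - x) = g y.
    apply: filterS (open_nbhs_nbhs (conj (Uo x) (Ux _ Wx))) => y.
    by move=> /(gE _ _ Wx).
  apply: (near_eq_diff E _).2.
  by apply: (@differentiableD _ _ _ id (cst (g x - x))) => //; exact: differentiable_cst.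
by rewrite dg/= /J' (gE x x Wx (Ux _ Wx)) J_per//; exact: UG.
Qed.

Fact latt_smooth i v : smooth_on (dm i) (fun x => J' i x v).
Proof. by move=> k; apply: Ck_onS (J_smooth v k). Qed.

Definition lattice_surface : almost_complex_surface R :=
  @AlmostComplexSurface R T latt_chart dm pr J' latt_open latt_inj latt_cover
    latt_hausdorff latt_trans latt_smooth (fun i x v _ => J_sq x v).

End LatticeSurface.

Definition U1 (R : realType) := {z : R[i] | `|z| == 1}.

Lemma normc_cos_sin (R : realType) (t : R) : `|cos t +i* sin t| == 1.
Proof. by rewrite normc_def/= cos2Dsin2 sqrtr1. Qed.

Definition expi (R : realType) (t : R) : U1 R :=
  exist (fun z : R[i] => `|z| == 1) (cos t +i* sin t) (normc_cos_sin t).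

Lemma expi_surj (R : realType) (u : U1 R) : exists t, expi t = u.
Proof.
case: u => [[x y] xy].
have xy1 : x ^+ 2 + y ^+ 2 = 1.
  move: xy; rewrite normc_def/= => /eqP[] E.
  have := sqr_sqrtr (addr_ge0 (sqr_ge0 x) (sqr_ge0 y)).
  by rewrite E expr1n.
have x1 : -1 <= x <= 1.
  have y2 := sqr_ge0 y; move: xy1 y2; rewrite !expr2 => xy1 y2.
  by apply/andP; split; nra.
have sE : Num.sqrt (1 - x ^+ 2) = `|y| by rewrite -xy1 addrC addKr sqrtr_sqr.
have [y0|y0] := leP 0 y.
  exists (acos x); apply: val_inj; rewrite /= sin_acos// acosK//.
  by rewrite sE ger0_norm.
exists (- acos x); apply: val_inj; rewrite /= cosN sinN sin_acos// acosK//.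
by rewrite sE ltr0_norm// opprK.
Qed.

Lemma cosDz (R : realType) (x : R) (n : int) : cos (x + 2 * pi *~ n) = cos x.
Proof.
have H y (k : nat) : cos (y + 2 * pi *+ k) = cos y :> R.
  by rewrite mulr_natl periodicn//; exact: cosD2pi.
case: n => k; first exact: H.
by rewrite NegzE mulrNz -[in RHS](subrK (2 * pi *+ k.+1) x) H.
Qed.

Lemma sinDz (R : realType) (x : R) (n : int) : sin (x + 2 * pi *~ n) = sin x.
Proof.
by rewrite -!cosBpihalf addrAC cosDz.
Qed.

Lemma cos_eq1 (R : realType) (d : R) : cos d = 1 -> exists n : int, d = 2 * pi *~ n.
Proof.
move=> d1; have p0 : 0 < 2 * pi :> R by rewrite mulr_gt0// pi_gt0.
pose n := Num.floor (d / (2 * pi)).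
exists n; pose r := d - 2 * pi *~ n.
have [r0 r2] : 0 <= r /\ r < 2 * pi.
  have /andP[] := real_floor_itv (num_real (d / (2 * pi))).
  rewrite -/n ler_pdivlMr// ltr_pdivrMr// mulrDl mul1r.
  rewrite /r -(mulrzr (2 * pi) n) (mulrC (2 * pi) n%:~R); lra.
have cr : cos r = 1 by rewrite /r -mulrNz cosDz.
suff : r = 0 by move=> /eqP; rewrite subr_eq0 => /eqP.
apply/eqP; case: eqVneq => // rn0.
have : 0 < sin (r / 2).
  have rgt0 : 0 < r by rewrite lt_neqAle eq_sym rn0.
  by apply: sin_gt0_pi; apply/andP; split; lra.
have : cos r = 1 - 2 * sin (r / 2) ^+ 2.
  rewrite [in LHS](splitr r) cosD.
  have := cos2Dsin2 (r / 2); rewrite !expr2; lra.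
rewrite cr => E s0; have : 0 < sin (r / 2) ^+ 2 by rewrite exprn_gt0.
by lra.
Qed.

Lemma expiP (R : realType) (x y : R) :
  expi x = expi y <-> exists n : int, x - y = 2 * pi *~ n.
Proof.
split=> [[cE sE]|[n xy]].
  apply: cos_eq1; rewrite cosB cE sE -!expr2; exact: cos2Dsin2.
by apply: val_inj; rewrite /= -(subrK y x) xy addrC cosDz sinDz.
Qed.

Section Circle_pullback.
Context {R : realType}.
Local Notation R3 := 'rV[R]_3.
Implicit Types (X : R3 -> R3) (c : R -> R3) (q v : R * R).

Definition bundle := (R3 * U1 R)%type.

(* The 1-form d theta + sum_i a_i dx_i at the point [p], evaluated at the tangent
   vector sum_i v.1_i d/dx_i + v.2 d/dtheta. *)
Definition conn_form X (p : bundle) (v : R3 * R) : R :=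
  v.2 + \sum_i X p.1 0 i * v.1 0 i.

(* A closed curve on [0, L] is represented by its [L]-periodic extension. *)
Definition smooth_closed_curve L c := smooth c /\ periodic c L.

(* The map induced on R/LZ; by [loop_mapE] it does not depend on the choice of
   representatives. *)
Definition loop_map L c (q : zquot [tuple L]) : R3 := c (repr q).

Lemma loop_mapE L c t : smooth_closed_curve L c ->
  loop_map c (zclass [tuple L] t) = c t.
Proof.
move=> [_ cL]; rewrite /loop_map.
have /zclassP/inIntSpan1[m] := zclassK (zclass [tuple L] t).
move=> /eqP; rewrite subr_eq addrC => /eqP ->.
have H y (k : nat) : c (y + L *+ k) = c y by exact: periodicn.
case: m => k; first exact: H.
by rewrite NegzE mulrNz -[in RHS](subrK (L *+ k.+1) t) H.
Qed.

Definition pullback L c := {e : zquot [tuple L] * bundle | loop_map c e.1 == e.2.1}.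

Fact pb_par_subproof L c (lc : smooth_closed_curve L c) q :
  loop_map c (zclass [tuple L] q.1) == c q.1.
Proof. by rewrite loop_mapE. Qed.

(* Coordinates (t, theta) on the pullback bundle. *)
Definition pb_par L c (lc : smooth_closed_curve L c) q : pullback L c :=
  exist _ (zclass _ q.1, (c q.1, expi q.2)) (pb_par_subproof lc q).

(* The connection form pulled back to the pullback bundle: the tangent vector
   v.1 d/dt + v.2 d/dtheta at the point of coordinates [q] is mapped to
   v.1 c' + v.2 d/dtheta by the differential of the bundle map to P. *)
Definition pb_form X c q v :=
  conn_form X (c q.1, expi q.2) (v.1 *: derive1 c q.1, v.2).

Definition vert : R * R := (0, 1).

(* The horizontal lift of the tangent field c': by [hliftP], the only lift
   d/dt + h d/dtheta in the kernel of the connection form. *)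
Definition hlift X c q : R * R := (1, - pb_form X c q (1, 0)).

Lemma hliftP X c q h : pb_form X c q (1, h) = 0 <-> (1, h) = hlift X c q.
Proof.
rewrite /hlift /pb_form /conn_form/= add0r.
by split=> [/eqP|[->]]; rewrite ?addNr// addr_eq0 => /eqP ->.
Qed.

(* The almost complex structure J: in view of [pb_decomp], it is the
   endomorphism characterized by [pb_acs_vert] and [pb_acs_hlift]. *)
Definition pb_acs X c q v : R * R :=
  pb_form X c q v *: hlift X c q - v.1 *: vert.

Lemma pb_acs_vert X c q : pb_acs X c q vert = hlift X c q.
Proof.
rewrite /pb_acs /= scale0r subr0 {1}/pb_form /conn_form /=.
by rewrite scale0r big1 ?addr0 ?scale1r// => i _; rewrite mxE mulr0.
Qed.

Lemma pb_acs_hlift X c q : pb_acs X c q (hlift X c q) = - vert.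
Proof. by rewrite /pb_acs (hliftP _ _ _ _).2// scale0r sub0r scale1r. Qed.

Fact pb_form_linear X c q : scalar (pb_form X c q).
Proof.
move=> k u v; rewrite /pb_form /conn_form/=.
set S := (S in _ + S = _); set U := (S in k * (_ + S)); set W := (S in _ + (_ + S)).
have -> : S = k * U + W.
  rewrite /S /U /W mulr_sumr -big_split/=; apply: eq_bigr => i _.
  by rewrite !mxE -[k *: u.1]/(k * u.1); ring.
rewrite -[k *: u.2]/(k * u.2); ring.
Qed.

Fact pb_acs_linear X c q : linear (pb_acs X c q).
Proof.
move=> k u v; rewrite /pb_acs pb_form_linear -[(k *: u + v).1]/(k * u.1 + v.1).
by rewrite scalerBr !scalerA !scalerDl opprD addrACA.
Qed.

HB.instance Definition _ X c q :=
  GRing.isLinear.Build R (R * R)%type (R * R)%type _ _ (pb_acs_linear X c q).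

Lemma pb_decomp X c q v : v.1 *: hlift X c q + pb_form X c q v *: vert = v.
Proof.
have FE : pb_form X c q v = v.1 * pb_form X c q (1, 0) + v.2.
  have -> : v = v.1 *: (1, 0) + (0, v.2).
    rewrite [LHS]surjective_pairing; congr (_, _) => /=.
      by rewrite addr0 [RHS]mulr1.
    by rewrite scaler0 add0r.
  rewrite pb_form_linear; congr (_ * _ + _) => /=.
    by rewrite addr0 [RHS]mulr1.
  rewrite /pb_form /conn_form/= scale0r big1 ?addr0 ?scaler0 ?add0r// => i _.
  by rewrite mxE mulr0.
rewrite FE [RHS]surjective_pairing; congr (_, _) => /=.
  by rewrite scaler0 addr0 [LHS]mulr1.
rewrite -[_ *: - _]/(_ * - _) -[_ *: 1]/(_ * 1); ring.
Qed.

Lemma pb_acs_sq X c q v : pb_acs X c q (pb_acs X c q v) = - v.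
Proof.
rewrite {2}/pb_acs linearB !linearZ/= pb_acs_vert pb_acs_hlift.
by rewrite !scalerN -opprD addrC pb_decomp.
Qed.

Lemma pb_acs_smooth X c v : smooth X -> smooth c ->
  smooth (fun q => pb_acs X c q v).
Proof.
move=> sX sc k; have o := @openT (R * R)%type.
have fst_cts : continuous (fst : R * R -> R) by move=> x; exact: cvg_fst.
have form_smooth w : Ck_on k setT (fun q => pb_form X c q w).
  apply: (Ck_onD o (Ck_on_cst k setT w.2)).
  apply: (Ck_on_sum o) => i.
  apply: (Ck_onM (f := fun q => X (c q.1) 0 i)) => //.
    apply: (Ck_on_prelin (f := fun t => X (c t) 0 i) (l := fst) fst_cts).
    apply: (Ck_on_comp_row (f := c) (g := fun x => X x 0 i)).
    - exact: openT.
    - exact: sc.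
    - by apply: Ck_on_coord; [exact: openT|exact: sX].
  apply: (Ck_on_prelin (f := fun t => (w.1 *: derive1 c t) 0 i) (l := fst) fst_cts).
  apply: (Ck_on_coord (f := fun t => w.1 *: derive1 c t)); first exact: openT.
  have -> : (fun t => w.1 *: derive1 c t) = ( *:%R w.1) \o 'D_1 c.
    by apply/funext => t; rewrite /= derive1E.
  by apply: Ck_on_lin; [exact: openT|exact: scaler_continuous|exact: (sc k.+1).2].
rewrite (_ : (fun q => _) = fun q => (pb_form X c q v,
   pb_form X c q v * (-1 * pb_form X c q (1, 0)) + - v.1)).
  apply: (Ck_on_pair o) => //.
  apply: (Ck_onD o); last exact: Ck_on_cst.
  apply: (Ck_onM o) => //; apply: (Ck_onM (f := cst (-1)) o) => //.
  exact: Ck_on_cst.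
apply/funext => q; rewrite /pb_acs [LHS]surjective_pairing; congr (_, _) => /=.
  by rewrite scaler0 subr0 [LHS]mulr1.
by rewrite -[_ *: - _]/(_ * - _) -[_ *: 1]/(_ * 1) mulr1 mulN1r.
Qed.

Lemma pb_par_surj L c (lc : smooth_closed_curve L c) e : exists q, pb_par lc q = e.
Proof.
case: e => [[s [x u]] /= ex]; have [t ut] := expi_surj u.
exists (repr s, t); apply: val_inj => /=; rewrite zclassK ut.
by move/eqP: ex => /= <-.
Qed.

Lemma pb_parP L c (lc : smooth_closed_curve L c) q q' :
  pb_par lc q = pb_par lc q' <->
  inIntSpan [tuple (L, 0); (0, 2 * pi)] (q - q').
Proof.
split=> [[/zclassP/inIntSpan1[m mE] _ cE sE]|/inIntSpan2[m [n qE]]].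
  have /expiP[n nE] : expi q.2 = expi q'.2 by apply: val_inj; rewrite /= cE sE.
  apply/inIntSpan2; exists m, n; rewrite !mulrz_pair/=.
  rewrite [LHS]surjective_pairing; congr (_, _) => /=.
    by rewrite mE mul0rz addr0.
  by rewrite nE mul0rz add0r.
have [E1 E2] : q.1 - q'.1 = L *~ m /\ q.2 - q'.2 = 2 * pi *~ n.
  split; first rewrite -[LHS]/((q - q').1); last rewrite -[LHS]/((q - q').2).
    by rewrite qE !mulrz_pair/= mul0rz addr0.
  by rewrite qE !mulrz_pair/= mul0rz add0r.
have z12 : zclass [tuple L] q.1 = zclass _ q'.1.
  by apply/zclassP/inIntSpan1; exists m.
have e12 : expi q.2 = expi q'.2 by apply/expiP; exists n.
apply: val_inj => /=; rewrite z12 e12.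
by rewrite -[in RHS](loop_mapE _ lc) -z12 loop_mapE.
Qed.

Lemma pb_latt_indep (L : R) : 0 < L ->
  ((L, 0) : R * R).1 * ((0, 2 * pi) : R * R).2 -
  ((L, 0) : R * R).2 * ((0, 2 * pi) : R * R).1 != 0.
Proof. by move=> L0 /=; rewrite mul0r subr0 !mulf_neq0// gt_eqF// pi_gt0. Qed.

Lemma pb_acs_per X L c v q g : smooth_closed_curve L c ->
  inIntSpan [tuple (L, 0); (0, 2 * pi)] g ->
  pb_acs X c (q + g) v = pb_acs X c q v.
Proof.
move=> lc /inIntSpan2[m [n gE]].
have E : (q + g).1 = q.1 + L *~ m.
  by rewrite -[LHS]/(q.1 + g.1) gE !mulrz_pair/= mul0rz addr0.
have cE t : c (t + L *~ m) = c t.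
  rewrite -!(loop_mapE _ lc); congr (loop_map c _); apply/zclassP/inIntSpan1.
  by exists m; rewrite addrC addKr.
have dE t : derive1 c (t + L *~ m) = derive1 c t.
  rewrite /derive1 (_ : (fun h => _) = (fun h => h^-1 *: (c (h + t) - c t)))//.
  by apply/funext => h; rewrite addrA !cE.
have FE w : pb_form X c (q + g) w = pb_form X c q w.
  by rewrite /pb_form /conn_form E/= cE dE.
by rewrite /pb_acs /hlift !FE.
Qed.

Definition pullback_torus X L c (sX : smooth X) (L0 : 0 < L)
    (lc : smooth_closed_curve L c) : almost_complex_surface R :=
  lattice_surface (J := fun q => pb_acs X c q)
    (pb_latt_indep L0) (pb_par_surj lc) (pb_parP lc)
    (fun q g v => @pb_acs_per X L c v q g lc)
    (fun v => pb_acs_smooth v sX lc.1) (pb_acs_sq X c).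

(* Multiplication by i on C = R^2. *)
Definition mul_i (z : R * R) : R * R := (- z.2, z.1).

Fact mul_i_linear : linear mul_i.
Proof.
move=> k u v; rewrite /mul_i [RHS]surjective_pairing; congr (_, _) => //=.
by rewrite opprD scalerN.
Qed.

HB.instance Definition _ :=
  GRing.isLinear.Build R (R * R)%type (R * R)%type _ _ mul_i_linear.

Definition ct_par (w1 w2 : R[i]) (z : R * R) : zquot [tuple w1; w2] :=
  zclass _ (z.1 +i* z.2).

Lemma ct_par_surj w1 w2 p : exists z, ct_par w1 w2 z = p.
Proof.
exists (complex.Re (repr p), complex.Im (repr p)); rewrite /ct_par/= -[RHS]zclassK.
by case: (repr p).
Qed.

Definition pair_of_complex (w : R[i]) : R * R := (complex.Re w, complex.Im w).

Lemma ct_parP w1 w2 z z' : ct_par w1 w2 z = ct_par w1 w2 z' <->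
  inIntSpan [tuple pair_of_complex w1; pair_of_complex w2] (z - z').
Proof.
pose toC (u : R * R) : R[i] := u.1 +i* u.2.
have toCB (u v : R * R) : toC u - toC v = toC (u - v) by [].
have ofB (u v : R[i]) : pair_of_complex (u - v) = pair_of_complex u - pair_of_complex v.
  by case: u => ? ?; case: v.
have ofM (u : R[i]) m : pair_of_complex (u *~ m) = pair_of_complex u *~ m.
  have H k : pair_of_complex (u *+ k) = pair_of_complex u *+ k.
    elim: k => [//|k IH]; rewrite !mulrS -IH.
    by case: u {IH} => a b; case: (_ *+ k).
  case: m => k; first exact: H.
  by rewrite !NegzE !mulrNz -[in LHS]sub0r ofB H sub0r.
have ofD (u v : R[i]) : pair_of_complex (u + v) = pair_of_complex u + pair_of_complex v.
  by case: u => ? ?; case: v.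
have ofK : cancel pair_of_complex toC by case.
have toK : cancel toC pair_of_complex by case.
rewrite /ct_par zclassP !inIntSpan2 -![_ +i* _]/(toC _) toCB.
split=> -[m [n E]]; exists m, n.
  by rewrite -[LHS]toK E ofD !ofM.
by rewrite E -[RHS]ofK ofD !ofM.
Qed.

Lemma mul_i_sq z : mul_i (mul_i z) = - z.
Proof. by []. Qed.

(* C/(Z w1 + Z w2). *)
Definition complex_torus (w1 w2 : R[i])
    (w_indep : complex.Re w1 * complex.Im w2 -
      complex.Im w1 * complex.Re w2 != 0) : almost_complex_surface R :=
  lattice_surface (g1 := pair_of_complex w1) (g2 := pair_of_complex w2)
    (J := fun=> mul_i) w_indep (@ct_par_surj w1 w2) (@ct_parP w1 w2)
    (fun _ _ _ _ => erefl) (fun v k => Ck_on_cst k setT (mul_i v))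
    (fun=> mul_i_sq).

Lemma periods_indep (a L : R) : 0 < L ->
  complex.Re (2 * pi)%:C * complex.Im (a +i* L) -
    complex.Im (2 * pi)%:C * complex.Re (a +i* L) != 0.
Proof. by move=> L0; rewrite /= mul0r subr0 !mulf_neq0// gt_eqF// pi_gt0. Qed.

Definition enorm (v : R3) : R := Num.sqrt (\sum_i v 0 i ^+ 2).

Definition unit_speed c := forall t, enorm (derive1 c t) = 1.

Definition circulation X c L : R :=
  \int[lebesgue_measure]_(t in `[0, L]) \sum_i X (c t) 0 i * derive1 c t 0 i.

End Circle_pullback.

Arguments complex_torus {R} w1 w2 w_indep.

(* Main.v *)
Require Import Defs.
From HB Require Import structures.
From mathcomp Require Import all_boot all_order all_algebra.
From mathcomp Require Import generic_quotient complex.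
From mathcomp Require Import all_classical all_reals all_analysis.
From mathcomp Require Import ring lra.

(** Write [a t = sum_i a_i(c t) c_i'(t)], so that the connection form reads
    [dtheta + a dt] in the coordinates [(t, theta)] of the pullback bundle, and let
    [A] be a primitive of [a] on the whole line. The lift [d/dt - a d/dtheta] is
    horizontal, hence [theta + A t] is constant along horizontal curves: the
    shear [(t, theta) |-> (theta + A t, t)] of the plane straightens the
    connection. It sends [d/dtheta] to [(1, 0)] and the horizontal lift to
    [(0, 1)], so it carries [J] to the multiplication by [i]
    ([shear_pseudo_holo], [unshear_pseudo_holo]).

    The density [a] is [L]-periodic and its integral over a period is the
    circulation of [X], so that [A (t + m L) = A t + m * circulation]
    ([quasi_periodic_primitive]). The shear therefore moves the translation by
    [(m L, 2 pi n)] to the translation by [(2 pi n + m * circulation, m L)], that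
    is, it matches the two lattices, and it descends to a bijection between the
    two quotients. Both quotients have for charts the injective restrictions of
    the projection from the plane, so a holomorphic diffeomorphism of the plane
    that is compatible with the projections descends to a biholomorphism
    ([biholomorphic_of_plane]). *)

Set Implicit Arguments.
Unset Strict Implicit.
Unset Printing Implicit Defensive.
Import Order.TTheory GRing.Theory Num.Theory numFieldNormedType.Exports.
Local Open Scope classical_set_scope.
Local Open Scope ring_scope.
Local Open Scope complex_scope.

(** * Primitives on the whole line *)

(** One of the two intervals is always empty: this is the oriented integral from
    0 to [t]. Intervals open on the left concatenate without overlap. *)
Definition signed_integral {R : realType} (a : R -> R) (t : R) : R :=
  \int[lebesgue_measure]_(s in `]0, t]) a s -
  \int[lebesgue_measure]_(s in `]t, 0]) a s.

Section SignedIntegral.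
Context {R : realType}.
Implicit Types (a A : R -> R).

Lemma continuous_segment_integrable a (u v : R) :
  continuous a -> lebesgue_measure.-integrable `[u, v] (EFin \o a).
Proof.
move=> ac; apply: continuous_compact_integrable; first exact: segment_compact.
exact: continuous_subspaceT.
Qed.

Lemma Rintegral_itv_oc_ge a (u v : R) : v <= u ->
  \int[lebesgue_measure]_(s in `]u, v]) a s = 0.
Proof. by move=> vu; rewrite set_itv_ge ?Rintegral_set0// bnd_simp -leNgt. Qed.

Lemma signed_integral0 a : signed_integral a 0 = 0.
Proof. by rewrite /signed_integral subrr. Qed.

Lemma signed_integral_ge0 a (t : R) : continuous a -> 0 <= t ->
  signed_integral a t = \int[lebesgue_measure]_(s in `[0, t]) a s.
Proof.
move=> ac t0; rewrite /signed_integral (Rintegral_itv_oc_ge _ t0) subr0.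
apply: Rintegral_itv_obnd_cbnd.
apply: (@integrableS _ _ _ lebesgue_measure `[0, t]) => //.
  by move=> x /=; exact: subset_itv_oc_cc.
exact: continuous_segment_integrable.
Qed.

(** Near a given point the base point 0 can be traded for one lying further to
    the left, which puts the oriented integral in the form required by the
    fundamental theorem of calculus. *)
Lemma signed_integral_rebase a (u t : R) : continuous a -> u < 0 -> u < t ->
  signed_integral a t = \int[lebesgue_measure]_(s in `[u, t]) a s -
    \int[lebesgue_measure]_(s in `[u, 0]) a s.
Proof.
move=> ac u0 ut; rewrite /signed_integral.
have [t0|/ltW t0] := leP 0 t.
  rewrite (Rintegral_itv_oc_ge _ t0) subr0 Rintegral_itvB ?bnd_simp ?(ltW u0)//.
  exact: continuous_segment_integrable.
rewrite (Rintegral_itv_oc_ge _ t0) sub0r -[RHS]opprB.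
rewrite Rintegral_itvB ?bnd_simp ?(ltW ut)//.
exact: continuous_segment_integrable.
Qed.

Lemma is_derive_signed_integral a (t : R) :
  continuous a -> is_derive t 1 (signed_integral a) (a t).
Proof.
move=> ac; pose u := Num.min 0 t - 1.
have m0 : Num.min 0 t <= 0 by rewrite ge_min lexx.
have mt : Num.min 0 t <= t by rewrite ge_min lexx orbT.
have u0 : u < 0 by rewrite /u; lra.
have ut : u < t by rewrite /u; lra.
pose F s := \int[lebesgue_measure]_(x in `[u, s]) a x.
have [dF F'] : derivable F t 1 /\ derive1 F t = a t.
  apply: (@continuous_FTC1 _ a (BLeft u) t (t + 1)) => //.
  - by rewrite ltrDl.
  - exact: continuous_segment_integrable.
  - exact: ac.
have FE : \forall s \near t, (F - cst (F 0)) s = signed_integral a s.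
  near=> s; rewrite (signed_integral_rebase ac u0)//.
  by near: s; exact: lt_nbhsr.
apply: near_eq_is_derive FE _; rewrite -[a t]subr0.
by apply: is_deriveB; rewrite -F' derive1E; exact/derivableP.
Unshelve. all: by end_near. Qed.

Lemma smooth_primitive a A :
  (forall t : R, is_derive t 1 A (a t)) -> smooth a -> smooth A.
Proof.
move=> dA sa.
have diffA t : differentiable A t by apply/derivable1_diffP; case: (dA t).
case=> [|k] /=; first by move=> t _; exact: differentiable_continuous.
split=> [t _ //|v].
apply: (eq_Ck_on openT _ (Ck_onM openT (Ck_on_cst k setT v) (sa k))) => t _ /=.
have [_ <-] := dA t.
by rewrite !deriveE// -[v in RHS]mulr1 linearZ.
Qed.

(** The increment of [A] over a period has derivative [a (t + L) - a t = 0]. *)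
Lemma quasi_periodic_primitive a A (L : R) :
  periodic a L -> (forall t : R, is_derive t 1 A (a t)) ->
  forall t (m : int), A (t + L *~ m) = A t + (A L - A 0) *~ m.
Proof.
move=> aL dA.
have AL t : A (t + L) = A t + (A L - A 0).
  have /(is_derive_0_is_cst t 0) /= :
      forall x : R, is_derive x 1 (A \o shift L - A) 0.
    move=> x.
    rewrite (_ : 0 = a (x + L) * 1 - a x); last by rewrite mulr1 aL subrr.
    have dS := is_derive1_comp (g := shift L) (dA (x + L)) (is_derive_shift x 1 L).
    exact: is_deriveB dS (dA x).
  rewrite !fctE /= add0r => E; rewrite -E; ring.
have H t (k : nat) : A (t + L *+ k) = A t + (A L - A 0) *+ k.
  by elim: k => [|k IH]; rewrite ?mulr0n ?addr0// !mulrSr addrA AL IH -addrA.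
move=> t [] k; first exact: H.
by rewrite NegzE !mulrNz -[in RHS](subrK (L *+ k.+1) t) H addrK.
Qed.

End SignedIntegral.

(** * Shears of the plane *)

Section Shear.
Context {R : realType}.
Implicit Types (a A : R -> R) (q v : R * R).

(** The two factors are exchanged because [theta] is to become the real part, and
    [t] the imaginary part, of the complex coordinate. *)
Definition shear A q : R * R := (q.2 + A q.1, q.1).
Definition unshear A q : R * R := (q.2, q.1 - A q.2).

Lemma shearK A : cancel (shear A) (unshear A).
Proof. by case=> s t; rewrite /unshear /shear /= addrK. Qed.

Lemma unshearK A : cancel (unshear A) (shear A).
Proof. by case=> s t; rewrite /unshear /shear /= subrK. Qed.

Lemma smooth_id (V : normedModType R) : smooth (@id V).
Proof.
move=> k; rewrite (_ : id = fun x : V => x + 0); first exact: smooth_shift.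
by apply/funext => x; rewrite addr0.
Qed.

Lemma smooth_fst : smooth (fst : R * R -> R).
Proof.
move=> k; apply: (Ck_on_prelin (l := fst) _ (@smooth_id _ k)) => x.
exact: cvg_fst.
Qed.

Lemma smooth_snd : smooth (snd : R * R -> R).
Proof.
move=> k; apply: (Ck_on_prelin (l := snd) _ (@smooth_id _ k)) => x.
exact: cvg_snd.
Qed.

Lemma smooth_shear A : smooth A -> smooth (shear A).
Proof.
move=> sA k; apply: Ck_on_pair; [exact: openT| |exact: smooth_fst].
apply: Ck_onD; [exact: openT|exact: smooth_snd|].
by apply: (Ck_on_prelin (l := fst) _ (sA k)) => x; exact: cvg_fst.
Qed.

Lemma smooth_unshear A : smooth A -> smooth (unshear A).
Proof.
move=> sA k; apply: Ck_on_pair; [exact: openT|exact: smooth_snd|].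
rewrite (_ : (fun x : R * R => _) = (fun x => x.1 + (-1) * A x.2)); last first.
  by apply/funext => x; rewrite mulN1r.
apply: Ck_onD; [exact: openT|exact: smooth_fst|].
apply: Ck_onM; [exact: openT|exact: (Ck_on_cst k setT (-1 : R))|].
by apply: (Ck_on_prelin (l := snd) _ (sA k)) => x; exact: cvg_snd.
Qed.

Lemma is_diff_fst q : is_diff q (fst : R * R -> R) fst.
Proof.
have c : continuous (fst : R * R -> R) by move=> x; exact: cvg_fst.
by apply: DiffDef; [exact: linear_differentiable|exact: diff_lin].
Qed.

Lemma is_diff_snd q : is_diff q (snd : R * R -> R) snd.
Proof.
have c : continuous (snd : R * R -> R) by move=> x; exact: cvg_snd.
by apply: DiffDef; [exact: linear_differentiable|exact: diff_lin].
Qed.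

Lemma is_diff_of_derive A (t b : R) :
  is_derive t 1 A b -> is_diff t A (fun h => h * b).
Proof.
move=> dA; have diffA : differentiable A t by apply/derivable1_diffP; case: dA.
apply: DiffDef => //; rewrite diff1E//; apply/funext => h.
by rewrite derive1E; case: dA => _ ->.
Qed.

Lemma diff_shear a A q v : (forall t : R, is_derive t 1 A (a t)) ->
  'd (shear A) q v = (v.2 + v.1 * a q.1, v.1).
Proof.
move=> dA; have d1 := is_diff_fst q; have d2 := is_diff_snd q.
have dA1 := is_diff_comp d1 (is_diff_of_derive (dA q.1)).
by rewrite (@diff_val _ _ _ _ _ _ _ (is_diff_pair (is_diffD d2 dA1) d1)).
Qed.

Lemma diff_unshear a A q v : (forall t : R, is_derive t 1 A (a t)) ->
  'd (unshear A) q v = (v.2, v.1 - v.2 * a q.2).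
Proof.
move=> dA; have d1 := is_diff_fst q; have d2 := is_diff_snd q.
have dA1 := is_diff_comp d2 (is_diff_of_derive (dA q.2)).
by rewrite (@diff_val _ _ _ _ _ _ _ (is_diff_pair d2 (is_diffB d1 dA1))).
Qed.

End Shear.

(** * Surfaces charted by a single map from the plane *)

Section PlaneCover.
Context {R : realType}.
Implicit Types (M N : almost_complex_surface R).

(** All charts are restrictions of the one map [Phi], whatever their domains, so
    that local questions on [M] can be settled in the plane with the almost
    complex structure [J]. *)
Definition plane_cover M (Phi : R * R -> M) (J : R * R -> R * R -> R * R) :=
  [/\ forall (i : chart M) x, par i x = Phi x,
      forall (i : chart M) x v, acs i x v = J x v &
      forall x, exists i : chart M, dom i x].

(** The points of the lattice other than 0 stay away from 0, hence small balls
    embed in the quotient and provide a chart around every point. *)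
Lemma lattice_surface_plane_cover (T : Type) (Phi : R * R -> T) (g1 g2 : R * R)
    (J : R * R -> {linear (R * R)%type -> (R * R)%type})
    (g_indep : g1.1 * g2.2 - g1.2 * g2.1 != 0)
    (Phi_surj : forall p, exists x, Phi x = p)
    (PhiP : forall x y, Phi x = Phi y <-> inIntSpan [tuple g1; g2] (x - y))
    (J_per : forall x g v, inIntSpan [tuple g1; g2] g -> J (x + g) v = J x v)
    (J_smooth : forall v, smooth (fun x => J x v))
    (J_sq : forall x v, J x (J x v) = - v) :
  plane_cover
    (M := lattice_surface g_indep Phi_surj PhiP J_per J_smooth J_sq) Phi J.
Proof.
split=> // x; have [e e0 eP] := lattice_gap g_indep.
have e20 : 0 < e / 2 by rewrite divr_gt0.
pose i : latt_chart Phi := exist _ _ (latt_ball PhiP eP x e20 (lexx _)).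
by exists i; exact: ballxx.
Qed.

Lemma plane_cover_surj M Phi J : @plane_cover M Phi J ->
  forall p, exists x, Phi x = p.
Proof.
move=> [PhiE _ _] p; have [a /(_ p)[n [x [_ xp]]]] := par_cover M.
by exists x; rewrite -(PhiE (a n)).
Qed.

Lemma holomorphic_of_plane M N Phi Phi' J J' (f : R * R -> R * R) (F : M -> N) :
  @plane_cover M Phi J -> @plane_cover N Phi' J' ->
  (forall x, F (Phi x) = Phi' (f x)) -> pseudo_holo J J' setT f ->
  holomorphic F.
Proof.
move=> [PhiE JE _] [PhiE' JE' cov'] FE [sf Jf] i x ix.
have [j jfx] := cov' (f x).
exists j, (dom i `&` f @^-1` dom j), f; split=> //.
- apply: openI; first exact: dom_open.
  apply: open_comp; last exact: dom_open.
  by move=> y _; exact: (sf 0%N y I).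
- by move=> y [_ jy]; rewrite PhiE PhiE' FE.
split=> [k|y v _]; first exact: Ck_onS (sf k).
by rewrite JE JE'; exact: Jf.
Qed.

Lemma biholomorphic_of_plane M N Phi Phi' J J' (f h : R * R -> R * R) :
  @plane_cover M Phi J -> @plane_cover N Phi' J' ->
  cancel f h -> cancel h f ->
  (forall x y, Phi x = Phi y <-> Phi' (f x) = Phi' (f y)) ->
  pseudo_holo J J' setT f -> pseudo_holo J' J setT h ->
  biholomorphic M N.
Proof.
move=> cM cN fK hK fP Jf Jh.
have surj := plane_cover_surj cM; have surj' := plane_cover_surj cN.
pose s p := sval (cid (surj p)).
pose s' p := sval (cid (surj' p)).
have sK p : Phi (s p) = p := svalP (cid (surj p)).
have sK' p : Phi' (s' p) = p := svalP (cid (surj' p)).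
pose F p := Phi' (f (s p)); pose G p := Phi (h (s' p)).
have FE x : F (Phi x) = Phi' (f x) by apply/fP; rewrite sK.
have GE x : G (Phi' x) = Phi (h x) by apply/fP; rewrite !hK sK'.
exists F, G; split.
- by move=> p; rewrite -[p]sK FE GE fK.
- by move=> p; rewrite -[p]sK' GE FE hK.
- exact: holomorphic_of_plane cM cN FE Jf.
- exact: holomorphic_of_plane cN cM GE Jh.
Qed.

End PlaneCover.

Lemma inIntSpan_pair (R : realType) (g1 g2 x : R * R) :
  inIntSpan [tuple g1; g2] x <-> exists m n : int,
    x.1 = g1.1 *~ m + g2.1 *~ n /\ x.2 = g1.2 *~ m + g2.2 *~ n.
Proof.
rewrite inIntSpan2; split=> -[m [n E]]; exists m, n.
  by rewrite E !mulrz_pair.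
by rewrite !mulrz_pair [LHS]surjective_pairing E.1 E.2.
Qed.

(** * The connection along the curve *)

Section CurveForm.
Context {R : realType}.
Variables (X : 'rV[R]_3 -> 'rV[R]_3) (c : R -> 'rV[R]_3).

(** The coefficient of [dt] in the pullback by [c] of the 1-form
    [sum_i a_i dx_i]. *)
Definition curve_form (t : R) : R := \sum_i X (c t) 0 i * derive1 c t 0 i.

Lemma smooth_curve_form : smooth X -> smooth c -> smooth curve_form.
Proof.
move=> sX sc k; apply: Ck_on_sum; first exact: openT.
move=> i; apply: (Ck_onM (f := fun t => X (c t) 0 i)); first exact: openT.
  apply: (Ck_on_comp_row (g := fun x => X x 0 i) openT (sc k)).
  exact: Ck_on_coord openT (sX k).
apply: Ck_on_coord; first exact: openT.
rewrite (_ : derive1 c = 'D_1 c); first exact: (sc k.+1).2.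
by apply/funext => t; rewrite derive1E.
Qed.

Lemma periodic_curve_form (L : R) : periodic c L -> periodic curve_form L.
Proof.
move=> cL t; rewrite /curve_form cL.
suff -> : derive1 c (t + L) = derive1 c t by [].
rewrite /derive1 (_ : (fun h => _) = (fun h => h^-1 *: (c (h + t) - c t)))//.
by apply/funext => h; rewrite addrA !cL.
Qed.

Lemma pb_formE q v : pb_form X c q v = v.2 + v.1 * curve_form q.1.
Proof.
rewrite /pb_form /conn_form /curve_form mulr_sumr; congr (_ + _).
by apply: eq_bigr => i _; rewrite mxE mulrCA.
Qed.

Lemma pb_acsE q v : pb_acs X c q v =
  (v.2 + v.1 * curve_form q.1,
   - (v.2 + v.1 * curve_form q.1) * curve_form q.1 - v.1).
Proof.
rewrite /pb_acs /hlift !pb_formE/= add0r mul1r [LHS]surjective_pairing/=.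
congr (_, _).
  rewrite -[_ *: 1]/(_ * 1) -[_ *: 0]/(_ * 0); ring.
rewrite -[_ *: 1]/(_ * 1) -[_ *: (- _)]/(_ * (- _)); ring.
Qed.

Variable A : R -> R.
Hypothesis A_smooth : smooth A.
Hypothesis dA : forall t : R, is_derive t 1 A (curve_form t).

(** The differential of the shear maps [v] to the pair formed of the connection
    form and of [dt] at [v]. These two forms are dual to the frame made of the
    vertical field and the horizontal lift, which [J] permutes up to sign as [i]
    does with 1 and [i]. *)
Lemma shear_pseudo_holo : pseudo_holo (pb_acs X c) (fun=> @mul_i R) setT (shear A).
Proof.
split=> [|q v _]; first exact: smooth_shear.
rewrite !(diff_shear _ _ dA) pb_acsE /mul_i/=; congr (_, _); ring.
Qed.

Lemma unshear_pseudo_holo :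
  pseudo_holo (fun=> @mul_i R) (pb_acs X c) setT (unshear A).
Proof.
split=> [|q v _]; first exact: smooth_unshear.
by rewrite !(diff_unshear _ _ dA) pb_acsE /mul_i/=; congr (_, _); ring.
Qed.

End CurveForm.

Theorem proposition1 (R : realType)
    (X : 'rV[R]_3 -> 'rV[R]_3) (X_smooth : smooth X)
    (L : R) (L_gt0 : 0 < L)
    (c : R -> 'rV[R]_3) (c_closed : smooth_closed_curve L c)
    (c_unit : unit_speed c) :
  biholomorphic
    (pullback_torus X_smooth L_gt0 c_closed)
    (complex_torus (2 * pi)%:C (circulation X c L +i* L)
      (periods_indep (circulation X c L) L_gt0)).
Proof.
have [c_smooth cL] := c_closed.
have a_smooth := smooth_curve_form X_smooth c_smooth.
have a_cts : continuous (curve_form X c) by move=> t; exact: (a_smooth 0%N t I).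
pose A := signed_integral (curve_form X c).
have dA (t : R) : is_derive t 1 A (curve_form X c t).
  exact: is_derive_signed_integral.
have A_smooth := smooth_primitive dA a_smooth.
have AL t (m : int) : A (t + L *~ m) = A t + circulation X c L *~ m.
  rewrite (quasi_periodic_primitive (periodic_curve_form X cL) dA).
  by rewrite [A 0]signed_integral0 subr0 [A L]signed_integral_ge0// ltW.
apply: (biholomorphic_of_plane _ _ (shearK A) (unshearK A)).
- exact: lattice_surface_plane_cover.
- exact: lattice_surface_plane_cover.
- (* the generators are listed in opposite orders in the two lattices *)
  move=> x y; rewrite pb_parP ct_parP !inIntSpan_pair/=.
  split=> -[m [n]]; rewrite !mul0rz ?addr0 ?add0r => -[E1 E2]; exists n, m.
    have -> : x.1 = y.1 + L *~ m by rewrite -E1 addrC subrK.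
    rewrite AL !mul0rz -E2; split; ring.
  rewrite !mul0rz ?addr0 ?add0r; move: E1.
  have -> : x.1 = y.1 + L *~ n by rewrite -E2 addrC subrK.
  by rewrite AL => E1; split; lra.
- exact: shear_pseudo_holo.
- exact: unshear_pseudo_holo.
Qed.
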